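(* For every $\varepsilon>0$ there exist $n_0$ and $\delta>0$ such that if $G$ is an $n$-vertex oriented graph with $n\ge n_0$ and $$t(G)+i(G)\le \tfrac19+\delta,$$ then $G$ is $\varepsilon$-close to $\mathcal B_n$.
   Context: An oriented graph is a directed graph with no loops and no multiple (parallel or anti-parallel) edges. For an oriented graph $G$, $t(G)$ (resp. $i(G)$) is the probability that a uniformly random $3$-set of vertices induces a transitive triangle (resp. an independent set). For a positive integer $n$, $\mathcal B_n=(V,E)$ is the balanced blowup of a cyclic triangle: $V$ is the disjoint union of $V_0,V_1,V_2$ with $|V_i|=\lfloor (n+i)/3\rfloor$, and $E$ consists of all directed edges from $V_i$ to $V_{i+1 \bmod 3}$ for $0\le i\le 2$. Two $n$-vertex graphs $G$ and $H$ are $\varepsilon$-close if there are sets $E_1,E_2\subseteq\binom{V(G)}{2}$ with $|E_1|+|E_2|\le\varepsilon n^2$ such that $(G\setminus E_1)\cup E_2$ is isomorphic to $H$. *)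

(* Defs.v *)
From HB Require Import structures.
From mathcomp Require Import all_boot all_order all_algebra.
From mathcomp Require Import reals.

Set Implicit Arguments.
Unset Strict Implicit.
Unset Printing Implicit Defensive.

Import Order.TTheory GRing.Theory Num.Theory.
Local Open Scope ring_scope.

Definition oriented (T : finType) (e : rel T) : Prop :=
  irreflexive e /\ (forall x y : T, e x y -> ~~ e y x).

Definition transitive_triangle (T : finType) (e : rel T) (S : {set T}) : bool :=
  [exists x, exists y, exists z,
    [&& S == [set x; y; z], e x y, e y z & e x z]].

Definition independent (T : finType) (e : rel T) (S : {set T}) : bool :=
  [forall x in S, forall y in S, ~~ e x y].

(* Probability that a uniformly random 3-set of vertices satisfies P; when
   there are fewer than three vertices the quotient is 0 / 0 = 0. *)
Definition triple_prob (R : realType) (T : finType) (P : pred {set T}) : R :=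
  #|[set S : {set T} | (#|S| == 3)%N && P S]|%:R / 'C(#|T|, 3)%:R.

Definition tdens (R : realType) (T : finType) (e : rel T) : R :=
  triple_prob R (transitive_triangle e).

Definition idens (R : realType) (T : finType) (e : rel T) : R :=
  triple_prob R (independent e).

(* The disjoint union of V_0, V_1, V_2 with |V_i| = floor((n + i) / 3):
   a vertex is a pair of a class i and an index inside V_i. *)
Definition blowup_vertex (n : nat) : finType :=
  {i : 'I_3 & 'I_((n + i) %/ 3)}.

Definition blowup (n : nat) : rel (blowup_vertex n) :=
  fun u v => (tag v == (tag u).+1 %% 3 :> nat)%N.
Arguments blowup : clear implicits.

Definition edit (T : finType) (e : rel T) (E1 E2 : {set T * T}) : rel T :=
  fun x y => (e x y && ((x, y) \notin E1)) || ((x, y) \in E2).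

Definition isomorphic (T U : finType) (e : rel T) (f : rel U) : Prop :=
  exists phi : T -> U,
    bijective phi /\ (forall x y : T, f (phi x) (phi y) = e x y).

(* Added edges need a direction, so E1 and E2 are sets of ordered pairs.  If f
   is oriented, the isomorphism prevents E2 from containing a loop or two
   opposite pairs, so |E2| is also the number of unordered pairs to which an
   edge is added.  Reversing an edge costs 2: one removal and one addition. *)
Definition close (R : realType) (eps : R) (T U : finType)
    (e : rel T) (f : rel U) : Prop :=
  exists E1 E2 : {set T * T},
    (#|E1| + #|E2|)%N%:R <= eps * #|T|%:R ^+ 2 /\ isomorphic (edit e E1 E2) f.

(* Main.v *)
(* Write r(u,v) in Z/3 for the relation of u to v: 0 if non-adjacent (or equal),
   1 if u -> v, 2 if v -> u.  In B_n, r(u,v) is the difference of the classes of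
   v and u, so r(u,v) + r(v,w) + r(w,u) = 0 on every triple; call a triple bad if
   this sum is nonzero.  A semidefinite (flag algebra) certificate on four
   vertices shows that, up to a positive factor, t + i - 1/9 bounds the sum of
   - the average over edges uv of the square of the density of vertices w for
     which uvw is bad, and
   - the average over u of the squared deviations of |N0(u)| from n/3 and of
     |N+(u)| from |N-(u)|.
   Every bad triple spans an edge, so by Cauchy-Schwarz few triples are bad, and
   some vertex u lies in few bad triples and has its three neighbourhoods of size
   about n/3.  As uvw is good exactly when r(v,w) = r(u,w) - r(u,v), the partition
   N0(u), N+(u), N-(u) then exhibits the blowup up to o(n^2) edits, without any
   removal lemma. *)
Require Import Defs.
From Stdlib Require Import ZArith.
From mathcomp Require Import all_boot all_order all_algebra.
From mathcomp Require Import ssrZ zify ring lra.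
From mathcomp Require Import reals.

Set Implicit Arguments.
Unset Strict Implicit.
Unset Printing Implicit Defensive.

Import Order.TTheory GRing.Theory Num.Theory.
Local Open Scope ring_scope.

(** * Symmetrization of sums over ordered quadruples *)

Section Symmetrization.

Variables (T : Type) (V : nmodType) (F : T -> T -> T -> T -> V).

(** Together these sum over the 24 permutations of the arguments, built along S_2 < S_3 < S_4: the
    coset representatives are the identity and the transpositions moving the last index. Invariance
    of [sum4] under transpositions is then enough. *)
Definition symm2 a b c d := F a b c d + F b a c d.
Definition symm3 a b c d := symm2 a b c d + symm2 a c b d + symm2 c b a d.
Definition symm4 a b c d :=
  symm3 a b c d + symm3 a b d c + symm3 a d c b + symm3 d b c a.

End Symmetrization.

Section SymmetricSums.

Variables (T : finType) (V : nmodType).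
Implicit Types F : T -> T -> T -> T -> V.

Definition sum4 F : V := \sum_a \sum_b \sum_c \sum_d F a b c d.

Lemma sum4_swap12 F : sum4 (fun a b c d => F b a c d) = sum4 F.
Proof. exact: exchange_big. Qed.

Lemma sum4_swap23 F : sum4 (fun a b c d => F a c b d) = sum4 F.
Proof. by apply: eq_bigr => a _; exact: exchange_big. Qed.

Lemma sum4_swap34 F : sum4 (fun a b c d => F a b d c) = sum4 F.
Proof. by do 2!(apply: eq_bigr => ? _); exact: exchange_big. Qed.

Lemma sum4_swap13 F : sum4 (fun a b c d => F c b a d) = sum4 F.
Proof.
rewrite (sum4_swap12 (fun a b c d => F c a b d)).
by rewrite (sum4_swap23 (fun a b c d => F b a c d)) sum4_swap12.
Qed.

Lemma sum4_swap24 F : sum4 (fun a b c d => F a d c b) = sum4 F.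
Proof.
rewrite (sum4_swap23 (fun a b c d => F a d b c)).
by rewrite (sum4_swap34 (fun a b c d => F a c b d)) sum4_swap23.
Qed.

Lemma sum4_swap14 F : sum4 (fun a b c d => F d b c a) = sum4 F.
Proof.
rewrite (sum4_swap12 (fun a b c d => F d a c b)).
by rewrite (sum4_swap24 (fun a b c d => F b a c d)) sum4_swap12.
Qed.

Lemma sum4D F G :
  sum4 (fun a b c d => F a b c d + G a b c d) = sum4 F + sum4 G.
Proof.
rewrite -big_split; apply: eq_bigr => a _.
rewrite -big_split; apply: eq_bigr => b _.
by rewrite -big_split; apply: eq_bigr => c _; rewrite -big_split.
Qed.

Lemma sum4_sum (I : Type) (s : seq I) (F : I -> T -> T -> T -> T -> V) :
  sum4 (fun a b c d => \sum_(i <- s) F i a b c d) = \sum_(i <- s) sum4 (F i).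
Proof.
elim: s => [|i s IH].
  rewrite big_nil /sum4; do 4!(apply: big1 => ? _); exact: big_nil.
rewrite big_cons -IH -sum4D.
by do 4!(apply: eq_bigr => ? _); rewrite big_cons.
Qed.

Lemma sum4_symm4 F : sum4 (symm4 F) = sum4 F *+ 24.
Proof.
rewrite 3!sum4D (sum4_swap34 (symm3 F)) (sum4_swap24 (symm3 F)) (sum4_swap14 (symm3 F)).
have -> : sum4 (symm3 F) = sum4 (symm2 F) *+ 3.
  by rewrite 2!sum4D (sum4_swap23 (symm2 F)) (sum4_swap13 (symm2 F)) 2!mulrS addrA.
have -> : sum4 (symm2 F) = sum4 F *+ 2 by rewrite sum4D sum4_swap12 mulr2n.
by rewrite -!mulrnA -!mulrnDr.
Qed.

End SymmetricSums.

(** * The four-vertex certificate and its finite verification *)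

Definition opp3 (x : nat) : nat := ((3 - x) %% 3)%N.

Definition holonomy (x y z : nat) : nat := ((x + y + z) %% 3)%N.

(* Row r(u,w), column r(v,w): the coefficient of a third vertex w relative to the
   pair (u,v). *)
Definition flag_matrix := seq (seq Z).
Definition flag (M : flag_matrix) (x y : nat) : Z := nth 0 (nth [::] M x) y.

Delimit Scope Z_scope with coqZ.

(* An entry (w, M) stands for the sum over the pairs (u,v) of
   w(r(u,v)) * (sum over x of M(r(u,x), r(v,x)))^2.  The entries come from rounding
   a numerical solution of the semidefinite program.  All these squares vanish on
   the blowup; the stability argument uses the last three. *)
Definition certificate : seq (seq Z * flag_matrix) := [::
  ([:: 1712; 0; 0], [:: [:: 2; 0; 0]; [:: 0; -1; 0]; [:: 0; 0; -1]]);
  ([:: 2372; 0; 0], [:: [:: 0; 1; -1]; [:: 1; 0; 0]; [:: -1; 0; 0]]);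
  ([:: 4048; 0; 0], [:: [:: 0; 1; 1]; [:: -1; 0; 0]; [:: -1; 0; 0]]);
  ([:: 868; 0; 0], [:: [:: 0; -1; 1]; [:: 1; 0; 2]; [:: -1; -2; 0]]);
  ([:: 0; 856; 0], [:: [:: 0; 2; 3]; [:: -3; 0; 0]; [:: -2; 0; 0]]);
  ([:: 0; 205; 0], [:: [:: -3; 0; -4]; [:: -4; 2; 1]; [:: 0; 8; 2]]);
  ([:: 0; 997; 0], [:: [:: 3; -2; 0]; [:: 0; -2; -1]; [:: -2; 0; -2]]);
  ([:: 0; 2; 0], [:: [:: 1; 1; 0]; [:: 0; 1; 1]; [:: 1; 0; 1]]);
  ([:: 16; 16; 16], [:: [:: 2; 2; 2]; [:: -1; -1; -1]; [:: -1; -1; -1]]);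
  ([:: 168; 168; 168], [:: [:: 0; 0; 0]; [:: 1; 1; 1]; [:: -1; -1; -1]])
]%coqZ.

(* The arguments are r(u,v), r(v,w), r(w,u): three nonzero values describe a
   transitive triangle unless they are all equal. *)
Definition empty_or_transitive (x y z : nat) : bool :=
  [&& x == 0, y == 0 & z == 0]%N ||
  [&& x != 0, y != 0, z != 0 & ~~ ((x == y) && (y == z))]%N.

Definition square_term (xab xac xad xbc xbd : nat) (s : seq Z * flag_matrix) : Z :=
  (nth 0 s.1 xab * (flag s.2 xac xbc * flag s.2 xad xbd))%R.

(* foldr instead of \sum, which does not compute. *)
Definition deficit (xab xac xad xbc xbd : nat) : Z :=
  ((7776)%coqZ *+ empty_or_transitive xab xbc (opp3 xac) - 864%coqZ
  - foldr +%R 0 (map (square_term xab xac xad xbc xbd) certificate))%R.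

(** The six arguments are the relations between vertices 0, 1, 2, 3 in the order 01, 02, 03, 12, 13,
    23. Since 864 = 7776/9, [deficit] is 7776 times (indicator - 1/9), minus the expanded
    squares. *)
Definition local_deficit (x y z t u v : nat) : Z :=
  symm4 (fun a b c d : nat =>
    let r i j := nth 0%N (nth [::] [:: [:: 0; x; y; z]; [:: opp3 x; 0; t; u];
        [:: opp3 y; opp3 t; 0; v]; [:: opp3 z; opp3 u; opp3 v; 0]]%N i) j in
    deficit (r a b) (r a c) (r a d) (r b c) (r b d)) 0 1 2 3.

Definition all6 (P : nat -> nat -> nat -> nat -> nat -> nat -> bool) :=
  let all3 p := all p (iota 0 3) in
  all3 (fun x => all3 (fun y => all3 (fun z =>
  all3 (fun t => all3 (fun u => all3 (fun v => P x y z t u v)))))).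

(** All 3^6 = 729 labelled oriented graphs on four vertices are checked. Repeated vertices give such
    a table too, with relation 0 between equal ones, so the global inequality has no lower-order
    error. *)
Lemma local_deficit_ge0_computed :
  all6 (fun x y z t u v => 0 <= local_deficit x y z t u v).
Proof. by vm_compute. Qed.

Lemma local_deficit_ge0 x y z t u v :
  (x < 3)%N -> (y < 3)%N -> (z < 3)%N -> (t < 3)%N -> (u < 3)%N -> (v < 3)%N ->
  0 <= local_deficit x y z t u v.
Proof.
have in3 w : (w < 3)%N -> w \in iota 0 3 by rewrite mem_iota.
move=> /in3 hx /in3 hy /in3 hz /in3 ht /in3 hu /in3 hv.
have /allP/(_ _ hx)/allP/(_ _ hy)/allP/(_ _ hz) := local_deficit_ge0_computed.
by move=> /allP/(_ _ ht)/allP/(_ _ hu)/allP/(_ _ hv).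
Qed.

(** * The certificate inequality in an oriented graph *)

Definition arc3 (T : finType) (e : rel T) (a b : T) : nat :=
  if e a b then 1 else if e b a then 2 else 0.

Section OrientedGraph.

Variables (T : finType) (e : rel T).
Hypothesis oriented_e : oriented e.

Local Notation r := (arc3 e).

Lemma arc3_lt a b : (r a b < 3)%N.
Proof. by rewrite /arc3; do 2?case: ifP. Qed.

Lemma arc3C a b : r b a = opp3 (r a b).
Proof.
rewrite /arc3; case: oriented_e => _ /(_ a b).
by case: (e a b); case: (e b a) => // /(_ isT).
Qed.

Lemma arc3_diag a : r a a = 0%N.
Proof. by case: oriented_e => irr _; rewrite /arc3 irr. Qed.

Lemma arc3_eq1 a b : (r a b == 1)%N = e a b.
Proof. by rewrite /arc3; case: (e a b) => //; case: (e b a). Qed.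

Definition pair_square (s : seq Z * flag_matrix) (a b : T) : Z :=
  (nth 0 s.1 (r a b) * (\sum_c flag s.2 (r a c) (r b c)) ^+ 2)%R.

(** Expanding each square over two third vertices [c] and [d] makes the right side minus the left
    side equal to [sum4] of [deficit]; the factor [#|T|] in front of the triple sum is the free
    choice of [d]. *)
Lemma certificate_inequality :
  \sum_(s <- certificate) \sum_a \sum_b pair_square s a b <=
  (#|T|%:R * \sum_a \sum_b \sum_c
     (7776)%coqZ *+ empty_or_transitive (r a b) (r b c) (r c a))
  - 864%coqZ * #|T|%:R ^+ 4 :> Z.
Proof.
set F := fun a b c d => deficit (r a b) (r a c) (r a d) (r b c) (r b d).
(* A single [deficit] can be negative; only its sum over the 24 orderings of a quadruple is
   nonnegative. *)
have : 0 <= sum4 F.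
  rewrite -(pmulrn_lge0 (sum4 F) (isT : 0 < 24)%N) -sum4_symm4.
  apply: sumr_ge0 => a _; apply: sumr_ge0 => b _.
  apply: sumr_ge0 => c _; apply: sumr_ge0 => d _.
  rewrite /symm4 /symm3 /symm2 /F.
  rewrite (arc3C a b) (arc3C a c) (arc3C a d) (arc3C b c) (arc3C b d) (arc3C c d).
  exact: (local_deficit_ge0 (arc3_lt a b) (arc3_lt a c) (arc3_lt a d)
          (arc3_lt b c) (arc3_lt b d) (arc3_lt c d)).
have -> : sum4 F =
    (#|T|%:R * \sum_a \sum_b \sum_c
       (7776)%coqZ *+ empty_or_transitive (r a b) (r b c) (r c a))
    - 864%coqZ * #|T|%:R ^+ 4
    - \sum_(s <- certificate) \sum_a \sum_b pair_square s a b.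
  transitivity (
     sum4 (fun a b c d : T =>
       (7776)%coqZ *+ empty_or_transitive (r a b) (r b c) (r c a)) +
     sum4 (fun a b c d : T => - 864%coqZ) +
     sum4 (fun a b c d => \sum_(s <- certificate)
       - square_term (r a b) (r a c) (r a d) (r b c) (r b d) s)).
    rewrite -2!sum4D; apply: eq_bigr => a _; apply: eq_bigr => b _.
    apply: eq_bigr => c _; apply: eq_bigr => d _.
    by rewrite /F /deficit -arc3C foldrE big_map sumrN.
  congr (_ + _ + _).
  - rewrite mulr_sumr; apply: eq_bigr => a _; rewrite mulr_sumr; apply: eq_bigr => b _.
    rewrite mulr_sumr; apply: eq_bigr => c _.
    by rewrite sumr_const mulr_natl.
  - rewrite /sum4 !sumr_const -!mulrnA mulNrn; congr (- _).
    by rewrite -[LHS]mulr_natr !natrM !exprS expr0 mulr1.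
  - rewrite sum4_sum -sumrN; apply: eq_bigr => s _.
    rewrite -sumrN; apply: eq_bigr => a _; rewrite -sumrN; apply: eq_bigr => b _.
    rewrite /pair_square expr2 big_distrlr mulr_sumr -sumrN.
    by apply: eq_bigr => c _; rewrite mulr_sumr -sumrN.
by rewrite subr_ge0.
Qed.

Definition bad a b c : bool := holonomy (r a b) (r b c) (r c a) != 0%N.

Definition nbad a b : nat := #|[set c | bad a b c]|.
Definition nclass a k : nat := #|[set b | r a b == k]|.
Definition ntriple : nat :=
  \sum_a \sum_b \sum_c empty_or_transitive (r a b) (r b c) (r c a).

Lemma pair_square_ge0 s a b : all (fun w => 0 <= w) s.1 -> 0 <= pair_square s a b.
Proof.
move=> /(all_nthP 0) h; apply: mulr_ge0; last exact: sqr_ge0.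
case: (ltnP (r a b) (size s.1)) => [|hs]; first exact: h.
by rewrite nth_default.
Qed.

(** The discarded entries have nonnegative weights, so their squares only help; the three that
    remain carry the stability information. *)
Lemma certificate_tail :
  \sum_(s <- drop 7 certificate) \sum_a \sum_b pair_square s a b <=
  \sum_(s <- certificate) \sum_a \sum_b pair_square s a b.
Proof.
rewrite -{2}(cat_take_drop 7 certificate) big_cat /= lerDr.
rewrite big_seq; apply: sumr_ge0 => s hs.
do 2!(apply: sumr_ge0 => ? _); apply: pair_square_ge0.
have /allP : all (fun s : seq Z * flag_matrix => all (fun w => 0 <= w) s.1)
    (take 7 certificate).
  by vm_compute.
by apply.
Qed.

(** As r(a,b) = 1, the holonomy vanishes exactly when r(b,c) = r(a,c) - 1 mod 3, which is where this
    matrix is zero. *)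
Lemma sum_flag_bad a b : e a b ->
  \sum_c flag [:: [:: 1; 1; 0]; [:: 0; 1; 1]; [:: 1; 0; 1]]%coqZ
    (r a c) (r b c) = (nbad a b)%:R.
Proof.
rewrite -arc3_eq1 => /eqP eab.
rewrite /nbad -sum1_card natr_sum [RHS]big_mkcond /=; apply: eq_bigr => c _.
rewrite inE /bad eab (arc3C a c).
by case: (r a c) (r b c) (arc3_lt a c) (arc3_lt b c) => [|[|[|?]]] [|[|[|?]]].
Qed.

(** The rows are constant, so the sum depends on [a] alone; the values 2, -1, -1 are three times the
    indicator of r(a,c) = 0, minus 1. *)
Lemma sum_flag_zero a b :
  \sum_c flag [:: [:: 2; 2; 2]; [:: -1; -1; -1]; [:: -1; -1; -1]]%coqZ
    (r a c) (r b c) = ((nclass a 0)%:R * 3 - #|T|%:R)%R :> Z.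
Proof.
rewrite /nclass -!sum1_card !natr_sum [X in X * _]big_mkcond /= mulr_suml -sumrB.
apply: eq_bigr => c _; rewrite inE.
by case: (r a c) (r b c) (arc3_lt a c) (arc3_lt b c) => [|[|[|?]]] [|[|[|?]]].
Qed.

Lemma sum_flag_diff a b :
  \sum_c flag [:: [:: 0; 0; 0]; [:: 1; 1; 1]; [:: -1; -1; -1]]%coqZ
    (r a c) (r b c) = ((nclass a 1)%:R - (nclass a 2)%:R)%R :> Z.
Proof.
rewrite /nclass -!sum1_card !natr_sum.
rewrite [X in X - _]big_mkcond [X in _ - X]big_mkcond /= -sumrB.
apply: eq_bigr => c _; rewrite !inE.
by case: (r a c) (r b c) (arc3_lt a c) (arc3_lt b c) => [|[|[|?]]] [|[|[|?]]].
Qed.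

Lemma natr_coqZ n : n%:R = Z.of_nat n.
Proof. by elim: n => // n IH; rewrite -natr1 IH; lia. Qed.

Lemma density_inequality_Z :
  2%:R * (\sum_a \sum_(b | e a b) (nbad a b)%:R ^+ 2)
  + #|T|%:R * (\sum_a (16%:R * ((nclass a 0)%:R * 3%:R - #|T|%:R) ^+ 2
                      + 168%:R * ((nclass a 1)%:R - (nclass a 2)%:R) ^+ 2))
  <= 7776%:R * #|T|%:R * ntriple%:R - 864%:R * #|T|%:R ^+ 4 :> Z.
Proof.
rewrite (natr_coqZ 2) (natr_coqZ 16) (natr_coqZ 168) (natr_coqZ 864) (natr_coqZ 7776).
have -> : 7776%coqZ * #|T|%:R * ntriple%:R = #|T|%:R * \sum_a \sum_b \sum_c
    (7776)%coqZ *+ empty_or_transitive (r a b) (r b c) (r c a).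
  rewrite [_ * #|T|%:R]mulrC -mulrA /ntriple natr_sum mulr_sumr; congr (_ * _).
  apply: eq_bigr => a _; rewrite natr_sum mulr_sumr; apply: eq_bigr => b _.
  by rewrite natr_sum mulr_sumr; apply: eq_bigr => c _; rewrite mulr_natr.
apply: le_trans (le_trans certificate_tail certificate_inequality).
rewrite /= !big_cons big_nil addr0 lerD //.
  rewrite mulr_sumr; apply: ler_sum => a _.
  rewrite mulr_sumr big_mkcond /=; apply: ler_sum => b _.
  rewrite /pair_square -arc3_eq1 /=; case: eqP => [eab|].
    by rewrite eab sum_flag_bad // -arc3_eq1 eab.
  by case: (r a b) (arc3_lt a b) => [|[|[|?]]] // _ _; rewrite mul0r.
(* With equal weights and a sum depending on [a] alone, summing over [b] only contributes the factor
   [#|T|]. *)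
have sumT (s : seq Z * flag_matrix) (w : nat) (f : T -> Z) :
    s.1 = nseq 3 (w%:R : Z) ->
    (forall a b, \sum_c flag s.2 (r a c) (r b c) = f a) ->
    \sum_a \sum_b pair_square s a b = #|T|%:R * \sum_a w%:R * f a ^+ 2.
  move=> hs hf; rewrite mulr_sumr; apply: eq_bigr => a _.
  rewrite -sum1_card natr_sum mulr_suml; apply: eq_bigr => b _.
  rewrite /pair_square hf hs mul1r.
  by case: (r a b) (arc3_lt a b) => [|[|[|?]]].
rewrite big_split mulrDr lerD //.
  by rewrite (sumT (_, _) 16%N _ erefl sum_flag_zero).
by rewrite (sumT (_, _) 168%N _ erefl sum_flag_diff).
Qed.

Lemma density_inequality (R : realType) :
  2 * (\sum_a \sum_(b | e a b) (nbad a b)%:R ^+ 2)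
  + #|T|%:R * (\sum_a (16 * ((nclass a 0)%:R * 3 - #|T|%:R) ^+ 2
                      + 168 * ((nclass a 1)%:R - (nclass a 2)%:R) ^+ 2))
  <= 7776 * #|T|%:R * ntriple%:R - 864 * #|T|%:R ^+ 4 :> R.
Proof.
(* Both sides are integer polynomials in the counts. Stated over any commutative ring, they are
   carried from [Z] to [R] by a ring morphism, which here is also monotone. *)
pose lhs (S : comNzRingType) (k l m : nat) : S :=
  k%:R * (\sum_a \sum_(b | e a b) (nbad a b)%:R ^+ 2)
  + #|T|%:R * (\sum_a (l%:R * ((nclass a 0)%:R * 3%:R - #|T|%:R) ^+ 2
                      + m%:R * ((nclass a 1)%:R - (nclass a 2)%:R) ^+ 2)).
pose rhs (S : comNzRingType) (k l : nat) : S :=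
  k%:R * #|T|%:R * ntriple%:R - l%:R * #|T|%:R ^+ 4.
have lhsE (f : {rmorphism Z -> R}) k l m : f (lhs _ k l m) = lhs _ k l m.
  rewrite rmorphD (rmorphM f k%:R) (rmorphM f #|T|%:R) !rmorph_nat !rmorph_sum.
  congr (_ * _ + _ * _).
    apply: eq_bigr => a _; rewrite rmorph_sum; apply: eq_bigr => b _.
    by rewrite rmorphXn rmorph_nat.
  apply: eq_bigr => a _.
  rewrite rmorphD (rmorphM f l%:R) (rmorphM f m%:R) !rmorphXn !rmorphB rmorphM.
  by rewrite !rmorph_nat.
have rhsE (f : {rmorphism Z -> R}) k l : f (rhs _ k l) = rhs _ k l.
  rewrite rmorphB (rmorphM f (k%:R * _)) (rmorphM f k%:R) (rmorphM f l%:R).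
  by rewrite rmorphXn !rmorph_nat.
pose f : {rmorphism Z -> R} := intr \o int_of_Z.
have f_mono x y : x <= y -> f x <= f y.
  move=> xy; rewrite -subr_ge0 -rmorphB /= ler0z.
  by have : 0 <= y - x; [rewrite subr_ge0 | case: (y - x)].
have : f (lhs _ 2%N 16%N 168%N) <= f (rhs _ 7776%N 864%N).
  exact: f_mono density_inequality_Z.
by rewrite lhsE rhsE.
Qed.

End OrientedGraph.

(** * From ordered triples to 3-sets *)

Lemma card_ordered_triples (T : finType) (P : pred {set T}) :
  (#|[set t : T * T * T | uniq [:: t.1.1; t.1.2; t.2] && P [set t.1.1; t.1.2; t.2]]|
   <= 6 * #|[set S : {set T} | (#|S| == 3) && P S]|)%N.
Proof.
set B := [set S : {set T} | _].
rewrite -sum1_card.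
rewrite (partition_big (fun t => [set t.1.1; t.1.2; t.2]) (mem B)) /=; last first.
  case=> [[a b] c]; rewrite !inE /= => /andP[abc ->]; rewrite andbT.
  have -> : [set a; b; c] = [set x in [:: a; b; c]].
    by apply/setP=> x; rewrite !inE orbA.
  have /card_uniqP abc3 : uniq [:: a; b; c] by rewrite /= !inE.
  by rewrite cardsE abc3.
rewrite mulnC -sum_nat_const; apply: leq_sum => S; rewrite inE => /andP[/eqP cS _].
rewrite sum1_card.
set A := (X in #|X|).
(* The fibre over [S] injects into the orderings of [S], of which there are 3! = 6. *)
apply: (@leq_trans (size (permutations (enum S)))); last first.
  by rewrite size_permutations ?enum_uniq // -cardE cS.
have inj : injective (fun t : T * T * T => [:: t.1.1; t.1.2; t.2]).
  by move=> [[a b] c] [[a' b'] c'] [-> -> ->].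
rewrite cardE -(size_map (fun t : T * T * T => [:: t.1.1; t.1.2; t.2])).
apply: uniq_leq_size; first by rewrite map_inj_uniq // enum_uniq.
move=> s /mapP[[[a b] c]]; rewrite mem_enum unfold_in inE /= => /andP[/andP[abc _] /eqP <-] ->.
rewrite mem_permutations; apply: uniq_perm => //; first exact: enum_uniq.
by move=> x; rewrite mem_enum !inE orbA.
Qed.

(** Each 3-set has six orderings, and the triples with a coincidence a = b, b = c or a = c number at
    most [#|T| ^ 2] for each of the three equations. *)
Lemma ntriple_le (T : finType) (e : rel T) : oriented e ->
  (ntriple e <=
   6 * (#|[set S : {set T} | (#|S| == 3) && transitive_triangle e S]|
        + #|[set S : {set T} | (#|S| == 3) && independent e S]|)
   + 3 * #|T| ^ 2)%N.
Proof.
move=> oe.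
have E (a b c : T) : (empty_or_transitive (arc3 e a b) (arc3 e b c) (arc3 e c a) <=
   (uniq [:: a; b; c] && transitive_triangle e [set a; b; c])
   + (uniq [:: a; b; c] && independent e [set a; b; c]) + ((a == b) + (b == c) + (a == c)))%N.
  rewrite /= !inE.
  have [->|ab] := eqVneq a b; first by case: (empty_or_transitive _ _ _); lia.
  have [->|bc] := eqVneq b c; first by case: (empty_or_transitive _ _ _); lia.
  have [->|ac] := eqVneq a c; first by case: (empty_or_transitive _ _ _); lia.
  rewrite /= !addn0; case M : (empty_or_transitive _ _ _) => //.
  suff : transitive_triangle e [set a; b; c] || independent e [set a; b; c].
    by case: (transitive_triangle e _); case: (independent e _).
  move: M; rewrite /empty_or_transitive => /orP[/and3P[h1 h2 h3]|/and4P[h1 h2 h3 h4]]; apply/orP.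
    right; apply/forall_inP => x xS; apply/forall_inP => y yS; rewrite -arc3_eq1.
    move: xS yS; rewrite !inE.
    have ba : arc3 e b a == 0%N by rewrite (arc3C oe a b) (eqP h1).
    have cb : arc3 e c b == 0%N by rewrite (arc3C oe b c) (eqP h2).
    have ac0 : arc3 e a c == 0%N by rewrite (arc3C oe c a) (eqP h3).
    by move=> /orP[/orP[]|] /eqP-> /orP[/orP[]|] /eqP->;
      rewrite ?(arc3_diag oe) // (eqP h1, eqP h2, eqP h3, eqP ba, eqP cb, eqP ac0).
  left; have trI x y z : e x y -> e y z -> e x z ->
      [set x; y; z] =i [set a; b; c] -> transitive_triangle e [set a; b; c].
    move=> exy eyz exz /setP S; apply/existsP; exists x; apply/existsP; exists y.
    by apply/existsP; exists z; rewrite -S eqxx exy eyz exz.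
  have step x y : arc3 e x y != 0%N ->
      (arc3 e x y = 1%N /\ e x y) \/ (arc3 e x y = 2 /\ e y x).
    by rewrite /arc3; case: (e x y); case: (e y x) => // _; [left | left | right].
  (* Of the eight orientations of the triangle, [h4] excludes the two cyclic ones; each of the other
     six is listed as source, middle, sink. *)
  move: h4; case: (step a b h1) => -[-> uab]; case: (step b c h2) => -[-> ubc];
    case: (step c a h3) => -[-> uca] // _.
  - by apply: (trI a b c) => // x; rewrite !inE.
  - by apply: (trI c a b) => // x; rewrite !inE; do 3!case: (_ == _).
  - by apply: (trI a c b) => // x; rewrite !inE; do 3!case: (_ == _).
  - by apply: (trI b c a) => // x; rewrite !inE; do 3!case: (_ == _).
  - by apply: (trI b a c) => // x; rewrite !inE; do 3!case: (_ == _).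
  - by apply: (trI c b a) => // x; rewrite !inE; do 3!case: (_ == _).
apply: (@leq_trans (\sum_a \sum_b \sum_c
   ((uniq [:: a; b; c] && transitive_triangle e [set a; b; c])
    + (uniq [:: a; b; c] && independent e [set a; b; c])
    + ((a == b) + (b == c) + (a == c))))%N).
  by do 3!(apply: leq_sum => ? _).
have S (f g : T -> T -> T -> nat) : (\sum_a \sum_b \sum_c (f a b c + g a b c) =
    \sum_a \sum_b \sum_c f a b c + \sum_a \sum_b \sum_c g a b c)%N.
  rewrite -big_split; apply: eq_bigr => a _; rewrite -big_split; apply: eq_bigr => b _.
  exact: big_split.
have C (P : pred {set T}) :
    (\sum_a \sum_b \sum_c (uniq [:: a; b; c] && P [set a; b; c])
     <= 6 * #|[set S : {set T} | (#|S| == 3) && P S]|)%N.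
  apply: leq_trans (card_ordered_triples P).
  rewrite -sum1_card [X in (_ <= X)%N]big_mkcond.
  rewrite pair_big pair_big /=; apply: leq_sum => -[[a b] c] _; rewrite in_set /=.
  by case: (_ && P _).
have D (a : T) : (\sum_b (a == b) = 1)%N.
  by rewrite (bigD1 a) //= eqxx big1 // => b; rewrite eq_sym => /negPf->.
have K (m : nat) (f : T -> nat) : (forall x, f x = m) -> (\sum_x f x = #|T| * m)%N.
  by move=> fm; rewrite -sum_nat_const; apply: eq_bigr => x _.
have D1 : (\sum_(a : T) \sum_(b : T) \sum_(c : T) (a == b) = #|T| ^ 2)%N.
  by rewrite -mulnn; apply: (K _ _) => a; rewrite exchange_big -[RHS]muln1; exact: (K 1%N).
have D2 : (\sum_(a : T) \sum_b \sum_(c : T) (b == c) = #|T| ^ 2)%N.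
  by rewrite -mulnn; apply: (K _ _) => a; rewrite -[RHS]muln1; exact: (K 1%N).
have D3 : (\sum_(a : T) \sum_(b : T) \sum_(c : T) (a == c) = #|T| ^ 2)%N.
  by rewrite -mulnn; apply: (K _ _) => a; rewrite -[RHS]muln1; exact: (K 1%N).
rewrite 4!S D1 D2 D3 mulnDr.
have := C (transitive_triangle e); have := C (independent e).
lia.
Qed.

(** * Symmetry and counting of bad triples *)

Section Bad.

Variables (T : finType) (e : rel T).
Hypothesis oriented_e : oriented e.

(** A transposition negates the holonomy modulo 3, so whether it vanishes does not depend on the
    order. *)
Lemma bad_swap12 a b c : bad e b a c = bad e a b c.
Proof.
rewrite /bad (arc3C oriented_e a b) (arc3C oriented_e c a) (arc3C oriented_e b c).
by case: (arc3 e a b) (arc3 e b c) (arc3 e c a) (arc3_lt e a b) (arc3_lt e b c)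
  (arc3_lt e c a) => [|[|[|?]]] [|[|[|?]]] [|[|[|?]]].
Qed.

Lemma bad_swap23 a b c : bad e a c b = bad e a b c.
Proof.
rewrite /bad (arc3C oriented_e a b) (arc3C oriented_e c a) (arc3C oriented_e b c).
by case: (arc3 e a b) (arc3 e b c) (arc3 e c a) (arc3_lt e a b) (arc3_lt e b c)
  (arc3_lt e c a) => [|[|[|?]]] [|[|[|?]]] [|[|[|?]]].
Qed.

Lemma bad_arc a b c :
  bad e a b c -> [|| e a b, e b a, e a c, e c a, e b c | e c b].
Proof.
by rewrite /bad /arc3; case: (e a b) (e b a) (e a c) (e c a) (e b c) (e c b)
  => [] [] [] [] [] [].
Qed.

(** A bad triple spans an edge, which occupies the first two places in at least one of the six
    orderings; by symmetry of [bad], all six reindexed sums equal the sum over edges. *)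
Lemma sum_nbad_le :
  (\sum_a \sum_b nbad e a b <= 6 * \sum_a \sum_(b | e a b) nbad e a b)%N.
Proof.
pose f a b c : nat := e a b && bad e a b c.
have nbadE (a b : T) : nbad e a b = (\sum_c bad e a b c)%N.
  by rewrite /nbad -sum1_card big_mkcond; apply: eq_bigr => c _; rewrite inE; case: bad.
set S := (\sum_a \sum_(b | e a b) _)%N.
have SE : S = (\sum_a \sum_b \sum_c f a b c)%N.
  apply: eq_bigr => a _; rewrite big_mkcond; apply: eq_bigr => b _.
  rewrite /f nbadE; case: (e a b) => //=.
  by rewrite big1.
have E213 : (\sum_a \sum_b \sum_c f b a c = S)%N by rewrite exchange_big SE.
have E132 : (\sum_a \sum_b \sum_c f a c b = S)%N.
  by rewrite SE; apply: eq_bigr => a _; rewrite exchange_big.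
have E231 : (\sum_a \sum_b \sum_c f b c a = S)%N.
  by rewrite SE exchange_big; apply: eq_bigr => a _; rewrite exchange_big.
have E312 : (\sum_a \sum_b \sum_c f c a b = S)%N.
  by under eq_bigr => a _ do rewrite exchange_big; rewrite exchange_big SE.
have E321 : (\sum_a \sum_b \sum_c f c b a = S)%N.
  by rewrite -E312 exchange_big.
have D (g h : T -> T -> T -> nat) : (\sum_a \sum_b \sum_c (g a b c + h a b c) =
    \sum_a \sum_b \sum_c g a b c + \sum_a \sum_b \sum_c h a b c)%N.
  rewrite -big_split; apply: eq_bigr => a _; rewrite -big_split.
  by apply: eq_bigr => b _; exact: big_split.
apply: (@leq_trans (\sum_a \sum_b \sum_c
    (f a b c + f b a c + f a c b + f c a b + f b c a + f c b a))%N).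
  apply: leq_sum => a _; apply: leq_sum => b _; rewrite nbadE.
  apply: leq_sum => c _; rewrite /f.
  rewrite (bad_swap12 a b c) (bad_swap23 a b c) (bad_swap12 a c b) (bad_swap23 a b c).
  rewrite (bad_swap23 b a c) (bad_swap12 a b c) (bad_swap12 b c a).
  rewrite (bad_swap23 b a c) (bad_swap12 a b c).
  case h: (bad e a b c) => //.
  by move: (bad_arc h); rewrite !andbT; do 6!case: (e _ _).
by rewrite 5!D -SE E213 E132 E312 E231 E321; lia.
Qed.

End Bad.

(** * A vertex in few bad triples with balanced neighbourhoods *)

Lemma triple_count (R : realType) (T : finType) (e : rel T) (x : R) :
  (3 <= #|T|)%N -> 0 <= x -> oriented e -> tdens R e + idens R e <= x ->
  (ntriple e)%:R <= x * #|T|%:R ^+ 3 + 3 * #|T|%:R ^+ 2.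
Proof.
move=> n3 x0 oe; rewrite /tdens /idens /triple_prob -mulrDl -natrD.
(* With at least three vertices the binomial is nonzero, so the quotient is a genuine density and
   the denominator can be cleared. *)
set A := (_ + _)%N; have C0 : 0 < 'C(#|T|, 3)%:R :> R by rewrite ltr0n bin_gt0.
rewrite ler_pdivrMr // => hA.
have C6 : 6 * 'C(#|T|, 3)%:R <= #|T|%:R ^+ 3 :> R.
  rewrite -natrX -natrM ler_nat (_ : 6 = 3`!)%N // mulnC bin_ffact.
  by rewrite !ffactnS ffactn0 muln1 !expnS expn0 muln1 leq_mul // leq_mul //; lia.
have : (ntriple e)%:R <= (6 * A + 3 * #|T| ^ 2)%N%:R :> R by rewrite ler_nat ntriple_le.
rewrite natrD (natrM _ 6) (natrM _ 3) natrX => /le_trans; apply.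
rewrite lerD2r; apply: le_trans (ler_wpM2l x0 C6).
by rewrite mulrCA ler_wpM2l.
Qed.

(** By averaging: if every vertex exceeded the bound, the total would be at least [eps * N ^+ 3],
    whereas [density_inequality] keeps it below a third of that. *)
Lemma exists_regular_vertex (R : realType) (eps : R) : 0 < eps ->
  exists (n0 : nat) (delta : R), 0 < delta /\
    forall (T : finType) (e : rel T), (n0 <= #|T|)%N -> oriented e ->
      tdens R e + idens R e <= 1 / 9 + delta ->
      exists a : T, (\sum_b nbad e a b)%N%:R
        + (16 * ((nclass e a 0)%:R * 3 - #|T|%:R) ^+ 2
           + 168 * ((nclass e a 1)%:R - (nclass e a 2)%:R) ^+ 2)
        <= eps * #|T|%:R ^+ 2.
Proof.
(* [kappa] is the AM-GM parameter, with 6 [kappa] = [eps] / 4. In [delta], the bound by [kappa] pays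
   for the division by 4 [kappa], and the bound by 1 controls the degree deviations. *)
move=> eps0; pose kappa := eps / 24; pose delta := eps * Num.min kappa 1 / 24 ^+ 4.
have kappa0 : 0 < kappa by rewrite divr_gt0.
have delta0 : 0 < delta by rewrite divr_gt0 ?exprn_gt0 // mulr_gt0 // lt_min kappa0 ltr01.
have d1 : delta * 24 ^+ 4 <= eps * kappa.
  rewrite /delta divfK ?expf_neq0 ?pnatr_eq0 //.
  by rewrite (ler_wpM2l (ltW eps0)) // ge_min lexx.
have d2 : delta * 24 ^+ 4 <= eps.
  rewrite /delta divfK ?expf_neq0 ?pnatr_eq0 //.
  by rewrite ger_pMr // ge_min lexx orbT.
exists (maxn 3 (Num.bound (3 / delta))), delta; split => // T e.
rewrite geq_max => /andP[n3 nd] oe ht.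
set N : R := #|T|%:R.
have N0 : 0 < N by rewrite ltr0n (leq_trans _ n3).
have N3 : 3 <= delta * N.
  rewrite mulrC -ler_pdivrMr //; apply: ltW.
  apply: (lt_le_trans (archi_boundP (divr_ge0 (ler0n _ 3) (ltW delta0)))).
  by rewrite ler_nat.
have hM := triple_count n3 (addr_ge0 (divr_ge0 ler01 (ler0n _ 9)) (ltW delta0)) oe ht.
have hD := density_inequality oe R.
pose D a : R := 16 * ((nclass e a 0)%:R * 3 - N) ^+ 2
           + 168 * ((nclass e a 1)%:R - (nclass e a 2)%:R) ^+ 2.
pose S2 : R := \sum_a \sum_(b | e a b) (nbad e a b)%:R ^+ 2.
pose S1 : R := \sum_a \sum_(b | e a b) (nbad e a b)%:R.
have D0 a : 0 <= D a by rewrite addr_ge0 // mulr_ge0 // ?sqr_ge0 // ler0n.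
have SD0 : 0 <= \sum_a D a by apply: sumr_ge0.
have S20 : 0 <= S2 by do 2!(apply: sumr_ge0 => ? _); exact: sqr_ge0.
(* The constant is 2 * 7776: one [delta] comes from the hypothesis, the other absorbs the degenerate
   triples through 3 <= [delta * N]. *)
have key : 2 * S2 + N * \sum_a D a <= 15552 * delta * N ^+ 4.
  have : 7776 * N * (ntriple e)%:R - 864 * N ^+ 4 <= 15552 * delta * N ^+ 4.
    have : 7776 * N * (ntriple e)%:R <= 7776 * N * ((1 / 9 + delta) * N ^+ 3 + 3 * N ^+ 2).
      by rewrite ler_wpM2l // mulr_ge0 // ltW.
    have : 3 * N ^+ 3 <= delta * N * N ^+ 3 by rewrite ler_wpM2r // exprn_ge0 // ltW.
    by rewrite !exprS expr0 !mulr1; lra.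
  exact: le_trans hD.
clear hD hM ht.
(* AM-GM: [N x <= kappa N^2 + x^2 / (4 kappa)] for each edge. *)
have cs : N * S1 <= kappa * N ^+ 4 + S2 / (4 * kappa).
  have -> : kappa * N ^+ 4 = \sum_(a : T) \sum_(b : T) kappa * N ^+ 2.
    by rewrite !sumr_const -mulrnA -mulr_natr natrM -/N; ring.
  rewrite mulr_sumr mulr_suml -big_split; apply: ler_sum => a _.
  rewrite mulr_sumr mulr_suml [X in X <= _]big_mkcond [X in _ <= _ + X]big_mkcond -big_split.
  apply: ler_sum => b _ /=; case: ifP => _; last first.
    by rewrite addr0 mulr_ge0 ?exprn_ge0 ?ltW.
  set x : R := (nbad e a b)%:R.
  rewrite -subr_ge0 (_ : _ - _ = (2 * kappa * N - x) ^+ 2 / (4 * kappa)).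
    by rewrite divr_ge0 ?sqr_ge0 // mulr_ge0 // ltW.
  by field; rewrite lt0r_neq0.
have hb : (\sum_a \sum_b nbad e a b)%N%:R <= 6 * S1.
  rewrite /S1; under [X in _ * X]eq_bigr => a _ do rewrite -natr_sum.
  by rewrite -natr_sum -natrM ler_nat sum_nbad_le.
have [/existsP[a ha]|/existsPn ha] :=
  boolP [exists a, (\sum_b nbad e a b)%N%:R + D a <= eps * N ^+ 2].
  by exists a.
exfalso.
have big : N * (eps * N ^+ 2) <= \sum_a ((\sum_b nbad e a b)%N%:R + D a).
  rewrite mulr_natl -sumr_const; apply: ler_sum => a _.
  by rewrite ltW // ltNge ha.
rewrite big_split -natr_sum /= in big.
pose X := eps * N ^+ 4; have X0 : 0 < X by rewrite mulr_gt0 ?exprn_gt0.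
have kX : kappa * N ^+ 4 = X / 24 by rewrite /kappa /X; field.
have N40 : 0 <= N ^+ 4 by rewrite exprn_ge0 // ltW.
have dX : delta * N ^+ 4 <= X / 24 ^+ 4.
  by rewrite ler_pdivlMr ?exprn_gt0 // mulrAC ler_wpM2r.
(* [key] gives S2 <= 7776 [delta] N^4, and 7776 / 4 = 1944. *)
have uX : S2 / (4 * kappa) <= 1944 * (X / 24 ^+ 4).
  rewrite ler_pdivrMr ?(mulr_gt0 _ kappa0) //.
  have : delta * 24 ^+ 4 * N ^+ 4 <= eps * kappa * N ^+ 4 by rewrite ler_wpM2r.
  have : 0 <= N * \sum_a D a by rewrite mulr_ge0 // ltW.
  have -> : 1944 * (X / 24 ^+ 4) * (4 * kappa) = 7776 * (eps * kappa * N ^+ 4) / 24 ^+ 4.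
    by rewrite /X; field.
  rewrite ler_pdivlMr ?exprn_gt0 //; move: key; lra.
have XA : X <= 6 * (N * S1) + N * \sum_a D a.
  have := ler_wpM2l (ltW N0) big; have := ler_wpM2l (ltW N0) hb.
  by rewrite /X !exprS expr0 mulr1; lra.
have : N * \sum_a D a <= 15552 * (X / 24 ^+ 4).
  apply: (@le_trans _ _ (15552 * (delta * N ^+ 4))); last by rewrite ler_wpM2l.
  by move: key S20; lra.
by move: XA cs uX X0; rewrite kX; lra.
Qed.

(** * Fitting a colouring to prescribed class sizes *)

Lemma card_tagged_ord (I : finType) (s : I -> nat) :
  #|{: {i : I & 'I_(s i)}}| = (\sum_i s i)%N.
Proof.
by rewrite card_tagged sumnE big_map big_enum; apply: eq_bigr => i _; rewrite card_ord.
Qed.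

(* Fill each class with as many vertices of the right colour as fit, and
   match the remaining vertices arbitrarily. *)
Lemma class_preserving_bijection (I T : finType) (c : T -> I) (s : I -> nat) :
  #|T| = (\sum_i s i)%N ->
  exists phi : T -> {i : I & 'I_(s i)}, bijective phi /\
    (#|[set v | tag (phi v) != c v]| <= \sum_i (#|[set v | c v == i]| - s i))%N.
Proof.
rewrite -card_tagged_ord => cTU.
pose rank v := index v (enum [set w | c w == c v]).
have rank_inj v w : c v = c w -> rank v = rank w -> v = w.
  move=> cvw; rewrite /rank cvw => /(congr1 (nth v (enum [set x | c x == c w]))).
  by rewrite !nth_index // mem_enum inE ?cvw.
(* The partial matching: [v] takes the slot numbered by its rank in its own class, if that slot
   exists. *)
pose pm v : option {i : I & 'I_(s i)} :=
  if insub (rank v) is Some j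
  then Some (Tagged (fun i => 'I_(s i)) (j : 'I_(s (c v)))) else None.
have pmE v u : pm v = Some u -> tag u = c v /\ tagged u = rank v :> nat.
  by rewrite /pm; case: insubP => // j _ jE [<-].
have pmN v : (pm v == None) = (s (c v) <= rank v)%N.
  by rewrite /pm leqNgt; case: insubP => [j -> //|/negPf->].
have pm_inj v w u : pm v = Some u -> pm w = Some u -> v = w.
  move=> /pmE[tv rv] /pmE[tw rw]; apply: rank_inj; first by rewrite -tv.
  by rewrite -rv.
pose A := [set v | pm v != None]; pose B := [set u | [exists v, pm v == Some u]].
(* Only a default for [nth], available because the cardinalities agree; by [cAB] the index of an
   unmatched vertex stays in range. *)
pose base v : {i : I & 'I_(s i)} := enum_val (cast_ord cTU (enum_rank v)).
pose f v := if pm v is Some u then u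
  else nth (base v) (enum (~: B)) (index v (enum (~: A))).
have fB v u : pm v = Some u -> f v = u by rewrite /f => ->.
have cAB : #|~: A| = #|~: B|.
  suff -> : B = f @: A.
    rewrite [LHS]cardsCs [RHS]cardsCs !setCK cTU card_in_imset // => v w.
    rewrite !inE; case pv : (pm v) => [u|] // _; case pw : (pm w) => [u'|] // _.
    by rewrite (fB _ _ pv) (fB _ _ pw) => uu; apply: pm_inj pv _; rewrite pw uu.
  apply/setP=> u; rewrite inE; apply/existsP/imsetP => [[v /eqP pv]|[v]].
    by exists v; rewrite ?(fB _ _ pv) // inE pv.
  by rewrite inE; case pv : (pm v) => [u'|] // _ ->; exists v; rewrite pv (fB _ _ pv).
have fN v : pm v = None -> f v \in ~: B.
  move=> pv; rewrite -mem_enum /f pv; apply: mem_nth.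
  by rewrite -cardE -cAB cardE index_mem mem_enum !inE pv.
have fS v u : pm v = Some u -> f v \in B.
  by move=> pv; rewrite (fB _ _ pv) inE; apply/existsP; exists v; rewrite pv.
have f_inj : injective f.
  move=> v w; case pv : (pm v) => [u|]; case pw : (pm w) => [u'|].
  - by rewrite (fB _ _ pv) (fB _ _ pw) => uu; apply: pm_inj pv _; rewrite pw uu.
  - by move=> E; have := fN _ pw; rewrite -E inE (fS _ _ pv).
  - by move=> E; have := fN _ pv; rewrite E inE (fS _ _ pw).
  have iv x : pm x = None -> (index x (enum (~: A)) < size (enum (~: B)))%N.
    by move=> px; rewrite -cardE -cAB cardE index_mem mem_enum !inE px.
  have mem x : pm x = None -> x \in enum (~: A) by move=> px; rewrite mem_enum !inE px.
  rewrite /f pv pw (set_nth_default (base w)) ?iv // => /eqP.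
  rewrite nth_uniq ?iv ?enum_uniq // => /eqP /(congr1 (nth v (enum (~: A)))).
  by rewrite !nth_index ?mem.
exists f; split; first by apply: inj_card_bij => //; rewrite cTU.
(* Wrongly placed vertices are unmatched. Those of colour i have distinct ranks between [s i] and
   the class size, hence the truncated difference. *)
apply: (@leq_trans #|[set v | pm v == None]|).
  apply/subset_leq_card/subsetP => v; rewrite !inE; apply: contraR.
  by case pv : (pm v) => [u|] // _; rewrite (fB _ _ pv) (pmE _ _ pv).1.
rewrite -sum1_card (partition_big c xpredT) //=; apply: leq_sum => i _.
rewrite sum1_card -(size_iota (s i) (_ - _)).
set X := (X in #|X|).
rewrite cardE -(size_map rank); apply: uniq_leq_size.
  rewrite map_inj_in_uniq ?enum_uniq // => v w; rewrite !mem_enum /X !unfold_in.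
  move=> /andP[_ /eqP vi] /andP[_ /eqP wi]; apply: rank_inj.
  by rewrite vi.
move=> k /mapP[v]; rewrite mem_enum /X unfold_in inE pmN => /andP[sv /eqP vi] ->.
rewrite mem_iota -vi sv /=.
have : (rank v < #|[set w | c w == c v]|)%N by rewrite cardE index_mem mem_enum inE.
move: sv; lia.
Qed.

(** * Comparison with the blowup through the neighbourhoods of one vertex *)

Section Recolouring.

Variables (T : finType) (e : rel T) (a : T).
Hypothesis oriented_e : oriented e.

Definition colour (v : T) : 'I_3 := Ordinal (arc3_lt e a v).

(** For a good triple r(v,w) is the colour of [w] minus that of [v] modulo 3, and an edge from [v]
    to [w] means that this difference is 1. *)
Lemma edge_colour v w : ~~ bad e a v w ->
  e v w = (colour w == (colour v).+1 %% 3 :> nat)%N.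
Proof.
rewrite /bad negbK -arc3_eq1 /= (arc3C oriented_e a w).
by case: (arc3 e a v) (arc3 e v w) (arc3 e a w) (arc3_lt e a v) (arc3_lt e v w)
  (arc3_lt e a w) => [|[|[|?]]] [|[|[|?]]] [|[|[|?]]].
Qed.

Lemma card_colour (i : 'I_3) : #|[set v | colour v == i]| = nclass e a i.
Proof. by apply: eq_card => v; rewrite !inE. Qed.

Lemma sum_nclass : (nclass e a 0 + nclass e a 1 + nclass e a 2 = #|T|)%N.
Proof.
have -> : #|T| = (\sum_(i < 3) nclass e a i)%N.
  rewrite -sum1_card (partition_big colour predT) //=; apply: eq_bigr => i _.
  by rewrite sum1_card -card_colour; apply: eq_card => v; rewrite inE.
by rewrite !big_ord_recr big_ord0.
Qed.

Lemma card_bad_pairs : #|[set p | bad e a p.1 p.2]| = (\sum_b nbad e a b)%N.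
Proof.
transitivity (\sum_b \sum_c bad e a b c)%N.
  rewrite pair_big -sum1_card big_mkcond /=.
  by apply: eq_bigr => -[b c] _; rewrite inE; case: bad.
apply: eq_bigr => b _; rewrite /nbad -sum1_card [RHS]big_mkcond.
by apply: eq_bigr => c _; rewrite inE; case: bad.
Qed.

(** A pair can disagree only if it forms a bad triple with [a] or one of its endpoints was placed
    outside its colour; the factor 2 is for the choice of endpoint. *)
Lemma edits_to_blowup (n : nat) (phi : T -> blowup_vertex n) :
  (#|[set p | e p.1 p.2 != blowup n (phi p.1) (phi p.2)]| <=
   \sum_b nbad e a b + 2 * (#|T| * #|[set v | tag (phi v) != colour v]|))%N.
Proof.
set P := [set p | _]; set M := [set v | _].
rewrite -card_bad_pairs.
have : P \subset [set p | bad e a p.1 p.2] :|: (setX setT M :|: setX M setT).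
  apply/subsetP => -[v w]; rewrite !inE /=; apply: contraR.
  rewrite 2!negb_or andbT => /and3P[nb /negPn/eqP cw /negPn/eqP cv].
  by rewrite /blowup cv cw (edge_colour nb) eqxx.
move=> /subset_leq_card /leq_trans; apply.
rewrite (leq_trans (leq_card_setU _ _).1) // leq_add2l.
rewrite (leq_trans (leq_card_setU _ _).1) // !cardsX cardsT.
by rewrite mul2n -addnn leq_add2l mulnC.
Qed.

End Recolouring.

(** * Closeness and the final estimate *)

Lemma close_of_bijection (R : realType) (eps : R) (T U : finType) (e : rel T) (f : rel U)
    (phi : T -> U) : bijective phi ->
  #|[set p | e p.1 p.2 != f (phi p.1) (phi p.2)]|%:R <= eps * #|T|%:R ^+ 2 ->
  close eps e f.
Proof.
move=> phi_bij le_eps.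
pose E1 := [set p | e p.1 p.2 && ~~ f (phi p.1) (phi p.2)].
pose E2 := [set p | ~~ e p.1 p.2 && f (phi p.1) (phi p.2)].
exists E1, E2; split.
  rewrite -cardsUI (_ : E1 :&: E2 = set0) ?cards0 ?addn0; last first.
    by apply/setP => p; rewrite !inE; case: (e _ _); rewrite ?andbF.
  suff -> : E1 :|: E2 = [set p | e p.1 p.2 != f (phi p.1) (phi p.2)] by [].
  by apply/setP => p; rewrite !inE; case: (e _ _); case: (f _ _).
exists phi; split=> // x y; rewrite /edit !inE /=.
by case: (e x y); case: (f _ _).
Qed.

Lemma leq_third (n i : nat) : (n <= 3 * ((n + i) %/ 3) + 2)%N.
Proof. lia. Qed.

Lemma sum_thirds n : (\sum_(i < 3) (n + i) %/ 3 = n)%N.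
Proof. by rewrite !big_ord_recr big_ord0 /=; lia. Qed.

Theorem theorem1p4 (R : realType) (eps : R) (heps : 0 < eps) :
  exists (n0 : nat) (delta : R),
    0 < delta /\
    forall (n : nat) (T : finType) (e : rel T),
      (n0 <= n)%N -> #|T| = n -> oriented e ->
      tdens R e + idens R e <= 1 / 9 + delta ->
      close eps e (blowup n).
Proof.
(* Edit budget: bad pairs cost at most [eps] / 4 n^2 and misplaced vertices 6 n ([tau] n + 1), that
   is [eps] / 4 n^2 + 6 n, where 6 n <= [eps] / 2 n^2 once 12 <= [eps] n. The bound by [tau ^+ 2]
   turns squared deviations into deviations of at most [tau] n. *)
pose tau := eps / 24; have tau0 : 0 < tau by rewrite divr_gt0.
pose eps1 := Num.min (eps / 4) (tau ^+ 2).
have eps10 : 0 < eps1 by rewrite lt_min divr_gt0 ?exprn_gt0.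
have e1 : eps1 <= eps / 4 by rewrite ge_min lexx.
have e2 : eps1 <= tau ^+ 2 by rewrite ge_min lexx orbT.
have [n1 [delta [delta0 hdelta]]] := exists_regular_vertex eps10.
exists (maxn n1 (Num.bound (12 / eps))), delta; split=> // n T e.
rewrite geq_max => /andP[nn1 nb] cT oe ht.
have N0 : 12 <= eps * n%:R.
  rewrite mulrC -ler_pdivrMr //; apply: ltW.
  apply: (lt_le_trans (archi_boundP (divr_ge0 (ler0n _ 12) (ltW heps)))).
  by rewrite ler_nat.
have n1T : (n1 <= #|T|)%N by rewrite cT.
have [a] := hdelta T e n1T oe ht.
rewrite cT => ha.
have [phi [phi_bij hphi]] : exists phi : T -> blowup_vertex n, bijective phi /\
    (#|[set v | tag (phi v) != colour e a v]| <=
     \sum_(i < 3) (nclass e a i - (n + i) %/ 3))%N.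
  have [|phi [bij h]] := @class_preserving_bijection _ T (colour e a)
    (fun i : 'I_3 => (n + i) %/ 3)%N; first by rewrite cT sum_thirds.
  by exists phi; split => //; apply: leq_trans h _.
apply: (close_of_bijection phi_bij); rewrite cT.
have := edits_to_blowup a oe phi; rewrite cT -(ler_nat R) => /le_trans; apply.
set M := #|[set v | tag _ != _]| in hphi *.
set beta := (\sum_b nbad e a b)%N in ha *.
rewrite natrD !natrM.
pose z : R := (nclass e a 0)%:R; pose x : R := (nclass e a 1)%:R.
pose y : R := (nclass e a 2)%:R.
have xyz : z + x + y = n%:R by rewrite -!natrD sum_nclass cT.
have N1 : 0 <= n%:R :> R by [].
have tN : 0 <= tau * n%:R by rewrite mulr_ge0 // ltW.
have sqle (t : R) : t ^+ 2 <= eps1 * n%:R ^+ 2 -> `|t| <= tau * n%:R.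
  move=> ht2; rewrite -ler_sqr ?nnegrE // real_normK ?num_real // exprMn.
  by apply: (le_trans ht2); rewrite ler_wpM2r // exprn_ge0.
have [beta0 z0 xy0] : [/\ 0 <= beta%:R :> R, 0 <= (z * 3 - n%:R) ^+ 2 & 0 <= (x - y) ^+ 2].
  by rewrite !sqr_ge0 ler0n.
have hz : `|z * 3 - n%:R| <= tau * n%:R by apply: sqle; move: ha; rewrite -/z -/x -/y; lra.
have hxy : `|x - y| <= tau * n%:R by apply: sqle; move: ha; rewrite -/z -/x -/y; lra.
have hbeta : beta%:R <= eps1 * n%:R ^+ 2 by move: ha; rewrite -/z -/x -/y; lra.
(* Rounding down leaves B >= n/3 - 2/3, whence the extra 1; if A <= B the truncated difference is
   0. *)
have class_excess (A B : nat) : (n <= 3 * B + 2)%N ->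
    A%:R <= n%:R / 3 + tau * n%:R -> (A - B)%N%:R <= tau * n%:R + 1.
  rewrite -(ler_nat R) natrD natrM => hB hA; have [AB|BA] := leqP A B.
    by rewrite (eqP AB) addr_ge0.
  by rewrite natrB 1?ltnW //; lra.
have [hz1 hz2] : - (tau * n%:R) <= z * 3 - n%:R /\ z * 3 - n%:R <= tau * n%:R.
  by apply/andP; rewrite -ler_norml.
have [hxy1 hxy2] : - (tau * n%:R) <= x - y /\ x - y <= tau * n%:R.
  by apply/andP; rewrite -ler_norml.
have hz3 : z <= n%:R / 3 + tau * n%:R by move: hz2 tN; clear; lra.
(* Half the sum of x + y = n - z <= 2n/3 + [tau] n/3 and x - y <= [tau] n; the bound on y is
   symmetric. *)
have hx3 : x <= n%:R / 3 + tau * n%:R by move: hz1 hxy2 xyz tN; clear; lra.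
have hy3 : y <= n%:R / 3 + tau * n%:R by move: hz1 hxy1 xyz tN; clear; lra.
have hM : M%:R <= 3 * (tau * n%:R + 1).
  move: hphi; rewrite -(ler_nat R) => /le_trans; apply.
  rewrite !big_ord_recr big_ord0 /= add0n !natrD.
  have h0 := class_excess _ _ (leq_third n 0) hz3.
  have h1 := class_excess _ _ (leq_third n 1) hx3.
  have h2 := class_excess _ _ (leq_third n 2) hy3.
  set w := tau * n%:R + 1 in h0 h1 h2 *.
  by rewrite (_ : 3 * w = w + w + w) ?lerD //; ring.
have : n%:R * M%:R <= n%:R * (3 * (tau * n%:R + 1)) by rewrite ler_wpM2l.
have : 12 * n%:R <= eps * n%:R * n%:R by rewrite ler_wpM2r.
have : eps1 * n%:R ^+ 2 <= eps / 4 * n%:R ^+ 2 by rewrite ler_wpM2r // exprn_ge0.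
by move: hbeta; rewrite /tau !expr2; lra.
Qed.
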